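(* Let $q$ be a fixed positive integer and $\beta>0$. The pair of empirical vectors $(L_n,L_n)$, i.e. $(\sigma,\tau)\mapsto (L_n(\sigma),L_n(\tau))$, satisfies the large deviation principle (with speed $n$) with respect to the Gibbs measures $P_{n,n,\beta}$ on $\mathcal{P}_q\times\mathcal{P}_q$ with rate function $$I_\beta(\gamma,\nu)=R(\gamma|\rho)+R(\nu|\rho)+\beta H(\gamma,\nu)-\inf_{(\gamma',\nu')\in\mathcal{P}_q\times\mathcal{P}_q}\{R(\gamma'|\rho)+R(\nu'|\rho)+\beta H(\gamma',\nu')\},$$ where $H(x,y)=-\langle x,y\rangle$. Specifically, for any closed subset $F$ of $\mathcal{P}_q\times\mathcal{P}_q$, $$\limsup_{n\to\infty}\frac1n\log P_{n,n,\beta}\big((L_n,L_n)\in F\big)\le-\inf_{(\gamma,\nu)\in F}I_\beta(\gamma,\nu),$$ and for any open subset $G$ of $\mathcal{P}_q\times\mathcal{P}_q$, $$\liminf_{n\to\infty}\frac1n\log P_{n,n,\beta}\big((L_n,L_n)\in G\big)\ge-\inf_{(\gamma,\nu)\in G}I_\beta(\gamma,\nu).$$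
   Context: Let $\Lambda=\{e^1,\dots,e^q\}$ be the standard basis of $\mathbb{R}^q$ (the spin values). A configuration of the Potts model on the complete bipartite graph $K_{n,n}$ is a pair $(\sigma,\tau)\in\Lambda^n\times\Lambda^n$ ($\sigma$ on the left vertices, $\tau$ on the right vertices). The Hamiltonian is $H_n(\sigma,\tau)=-\frac1n\sum_{i=1}^n\sum_{j=1}^n\delta(\sigma_i,\tau_j)$, where $\delta(u,v)=1$ if $u=v$ and $0$ otherwise. The Gibbs measure at inverse temperature $\beta>0$ is $$P_{n,n,\beta}(\sigma,\tau)=\frac{1}{Z_{n,n}(\beta)}e^{-\beta H_n(\sigma,\tau)}q^{-2n},\qquad Z_{n,n}(\beta)=\sum_{\sigma,\tau\in\Lambda^n}e^{-\beta H_n(\sigma,\tau)}q^{-2n}.$$ For $\omega\in\Lambda^n$, the magnetization (empirical) vector $L_n(\omega)=(L_{n,1}(\omega),\dots,L_{n,q}(\omega))$ has components $L_{n,k}(\omega)=\frac1n\sum_{i=1}^n\delta(\omega_i,e^k)$. $\mathcal{P}_q=\{\nu\in\mathbb{R}^q:\nu_k\ge0,\ \sum_{k=1}^q\nu_k=1\}$, with its usual (relative) topology. $\rho=(1/q,\dots,1/q)$, and $R(\nu|\rho)=\sum_{k=1}^q\nu_k\log(\nu_k/\rho_k)$ is the relative entropy (with $0\log0=0$). $\langle\cdot,\cdot\rangle$ is the Euclidean inner product on $\mathbb{R}^q$. The event $(L_n,L_n)\in F$ means $\{(\sigma,\tau)\in\Lambda^n\times\Lambda^n:(L_n(\sigma),L_n(\tau))\in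 F\}$. The infimum over the empty set is $+\infty$. *)

(* Defs.v *)
From HB Require Import structures.
From mathcomp Require Import all_boot all_order all_algebra.
From mathcomp Require Import all_classical all_reals all_analysis.

Set Implicit Arguments.
Unset Strict Implicit.
Unset Printing Implicit Defensive.

Import Order.TTheory GRing.Theory Num.Theory.
Import numFieldNormedType.Exports.

Local Open Scope classical_set_scope.
Local Open Scope ring_scope.

(** ** Large deviation principles on a subset of a topological space *)

Definition relatively_open (T : topologicalType) (D A : set T) : Prop :=
  exists2 U : set T, open U & A = U `&` D.

Definition relatively_closed (T : topologicalType) (D A : set T) : Prop :=
  exists2 C : set T, closed C & A = C `&` D.

Definition rate_function (R : realType) (T : topologicalType) (D : set T)
    (I : T -> \bar R) : Prop :=
  (forall x, D x -> (0 <= I x)%E) /\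
  (forall a : R, relatively_closed D [set x | D x /\ (I x <= a%:E)%E]).

(** [lne 0 = -oo], so sets of probability zero are treated correctly; the
    index [n = 0] is irrelevant to the limits. *)
Definition log_prob (R : realType) (T : Type) (mu : nat -> set T -> R)
    (A : set T) (n : nat) : \bar R :=
  ((n%:R^-1)%:E * lne (mu n A)%:E)%E.

(** LDP with speed [n] for a sequence of laws [mu n] on the space [D], which
    carries the topology induced by [T]. *)
Definition LDP (R : realType) (T : topologicalType) (D : set T)
    (mu : nat -> set T -> R) (I : T -> \bar R) : Prop :=
  [/\ rate_function D I,
      forall F : set T, relatively_closed D F ->
        (limn_esup (log_prob mu F) <= - ereal_inf [set I x | x in F])%E
    & forall G : set T, relatively_open D G ->
        (- ereal_inf [set I x | x in G] <= limn_einf (log_prob mu G))%E].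

(** ** The Potts model on the complete bipartite graph *)

(** The set of spin values is the standard basis of R^q. *)
Definition spin (R : realType) (q : nat) (k : 'I_q) : 'rV[R]_q := delta_mx 0 k.

Definition kron (R : realType) (q : nat) (u v : 'rV[R]_q) : R := (u == v)%:R.

(** A spin is recorded by its index: [w i = k] means that vertex [i] has the
    spin value [spin R k]. *)
Definition half_config (q n : nat) : finType := {ffun 'I_n -> 'I_q}.

Definition config (q n : nat) : finType :=
  (half_config q n * half_config q n)%type.

Definition hamiltonian (R : realType) (q n : nat) (s : config q n) : R :=
  - (n%:R^-1 * \sum_(i < n) \sum_(j < n) kron (spin R (s.1 i)) (spin R (s.2 j))).

Definition gibbs_weight (R : realType) (q n : nat) (beta : R)
    (s : config q n) : R :=
  expR (- beta * hamiltonian R s) * q%:R ^- (2 * n).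

Definition partition_function (R : realType) (q n : nat) (beta : R) : R :=
  \sum_(s : config q n) gibbs_weight beta s.

Definition gibbs_pmf (R : realType) (q n : nat) (beta : R)
    (s : config q n) : R :=
  (partition_function q n beta)^-1 * gibbs_weight beta s.

Definition gibbs_prob (R : realType) (q n : nat) (beta : R)
    (A : set (config q n)) : R :=
  \sum_(s : config q n | s \in A) gibbs_pmf beta s.

Definition magnetization (R : realType) (q n : nat) (w : half_config q n) :
    'rV[R]_q :=
  \row_k (n%:R^-1 * \sum_(i < n) kron (spin R (w i)) (spin R k)).

Definition magnetization_pair (R : realType) (q n : nat) (s : config q n) :
    'rV[R]_q * 'rV[R]_q :=
  (magnetization R s.1, magnetization R s.2).

Definition magnetization_law (R : realType) (q : nat) (beta : R) (n : nat)
    (A : set ('rV[R]_q * 'rV[R]_q)) : R :=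
  gibbs_prob beta (@magnetization_pair R q n @^-1` A).

(** ** The rate function *)

Definition simplex (R : realType) (q : nat) : set 'rV[R]_q :=
  [set nu | (forall k, 0 <= nu 0 k) /\ \sum_k nu 0 k = 1].
Arguments simplex : clear implicits.

Definition uniform_vec (R : realType) (q : nat) : 'rV[R]_q :=
  const_mx (q%:R^-1).

(** Only meaningful for [rho] with positive entries.  The convention
    [0 * log 0 = 0] holds because [ln 0] is a real number, so that its product
    with [0] vanishes. *)
Definition relative_entropy (R : realType) (q : nat) (nu rho : 'rV[R]_q) : R :=
  \sum_k nu 0 k * ln (nu 0 k / rho 0 k).

Definition inner (R : realType) (q : nat) (x y : 'rV[R]_q) : R :=
  \sum_k x 0 k * y 0 k.

Definition energy (R : realType) (q : nat) (x y : 'rV[R]_q) : R :=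
  - inner x y.

Definition free_energy (R : realType) (q : nat) (beta : R)
    (x : 'rV[R]_q * 'rV[R]_q) : R :=
  relative_entropy x.1 (uniform_vec R q) + relative_entropy x.2 (uniform_vec R q)
  + beta * energy x.1 x.2.

Definition potts_rate (R : realType) (q : nat) (beta : R)
    (x : 'rV[R]_q * 'rV[R]_q) : \bar R :=
  ((free_energy beta x)%:E -
   ereal_inf [set (free_energy beta y)%:E | y in simplex R q `*` simplex R q])%E.

(* Main.v *)
Require Import Defs.
From mathcomp Require Import all_boot all_order all_algebra.
From mathcomp Require Import all_classical all_reals all_analysis.
From mathcomp Require Import ring lra.

Import Order.TTheory GRing.Theory Num.Theory.
Import numFieldNormedType.Exports.
Local Open Scope classical_set_scope.
Local Open Scope ring_scope.
Set Implicit Arguments.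
Unset Strict Implicit.
Unset Printing Implicit Defensive.

(** Write [f] for the free energy and [D] for the product of the two simplices.
    The Hamiltonian depends on a configuration only through its two
    magnetizations, so its unnormalised Gibbs weight can be compared with any
    product measure: under independent spins with marginals [u.1] (left) and
    [u.2] (right), the density of the Gibbs weight is exactly
    [expR (- n * tilted_energy beta u y)] at every configuration whose spins all
    have positive mass, where [y] is the pair of magnetizations and
    [tilted_energy beta y y = f y] (lemma [gibbs_weight_tilt]).  This change of measure gives both bounds.

    Upper bound ([gibbs_mass_le]).  Take [u] to be the pair of magnetizations of
    the configuration itself, so that the density is [expR (- n * f y)].  The
    remaining product masses sum to at most [n.+1 ^ (2 * q)], as there are that
    many types and the configurations of one type have mass at most [1] under
    the product measure of that type.  Hence the Gibbs mass of any set on which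
    [f >= c] is at most a polynomial times [expR (- n * c)]; neither closedness
    nor compactness is needed.

    Lower bound ([gibbs_mass_ge]).  For [x] in a relatively open set, take
    [u = x].  By Chebyshev's inequality the pair of magnetizations is close to
    [x] with product probability at least one half, and there the continuous
    function [tilted_energy beta x] is close to its value [f x] at [x].

    Both bounds applied to [D] show that the normalising constant is
    [expR (- n * inf f)] to exponential order, and dividing yields the principle
    for the Gibbs measures.  Finally the sublevel sets of the rate are closed
    because on [D] the relative entropy is a supremum of affine functions, its
    tangents ([relative_entropy_ge], [cross_entropy_approx]). *)

(** * Magnetization and Hamiltonian *)

Section Magnetization.
Context {R : realType} {q n : nat}.
Implicit Types (w : half_config q n) (s : config q n) (p x : 'rV[R]_q).

Lemma kron_spin (k l : 'I_q) : kron (spin R k) (spin R l) = (k == l)%:R.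
Proof.
rewrite /kron; congr (_%:R); congr (nat_of_bool _).
apply/eqP/eqP => [/matrixP/(_ 0 k)|-> //].
rewrite !mxE !eqxx /=; case: (k =P l) => // _ /eqP.
by rewrite oner_eq0.
Qed.

Lemma magnetizationE w k :
  magnetization R w 0 k = n%:R^-1 * \sum_(i < n) (w i == k)%:R.
Proof. by rewrite mxE; under eq_bigr do rewrite kron_spin. Qed.

(** Averaging [h] against the empirical vector is averaging [h] over vertices. *)
Lemma sum_magnetization w (h : 'I_q -> R) :
  \sum_k magnetization R w 0 k * h k = n%:R^-1 * \sum_(i < n) h (w i).
Proof.
under eq_bigr do rewrite magnetizationE -mulrA mulr_suml.
rewrite -mulr_sumr exchange_big /=; congr (_ * _); apply: eq_bigr => i _.
rewrite (bigD1 (w i)) //= eqxx mul1r big1 ?addr0 // => k kwi.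
by rewrite eq_sym (negbTE kwi) mul0r.
Qed.

Lemma magnetization_simplex w : (0 < n)%N -> simplex R q (magnetization R w).
Proof.
move=> n0; split => [k|].
  by rewrite magnetizationE mulr_ge0 ?invr_ge0 // sumr_ge0.
have := sum_magnetization w (fun=> 1).
under eq_bigr do rewrite mulr1.
by move=> ->; rewrite sumr_const card_ord mulVf // pnatr_eq0 -lt0n.
Qed.

Lemma magnetization_gt0 w i : 0 < magnetization R w 0 (w i).
Proof.
have n0 : (0 < n)%N by apply: leq_ltn_trans (ltn_ord i).
rewrite magnetizationE mulr_gt0 ?invr_gt0 ?ltr0n // (bigD1 i) //= eqxx.
by rewrite ltr_wpDr // sumr_ge0.
Qed.

Lemma hamiltonianE s : (0 < n)%N ->
  hamiltonian R s = n%:R * energy (magnetization R s.1) (magnetization R s.2).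
Proof.
move=> n0; rewrite /hamiltonian /energy /inner mulrN; congr (- _).
rewrite sum_magnetization mulrA divff ?pnatr_eq0 -?lt0n // mul1r mulr_sumr.
apply: eq_bigr => i _; rewrite magnetizationE; congr (_ * _).
by apply: eq_bigr => j _; rewrite kron_spin eq_sym.
Qed.

End Magnetization.

(** * Independent spins *)

Section ProductMeasure.
Context {R : realType} {q n : nat}.
Implicit Types (w : half_config q n) (p x : 'rV[R]_q).

(** The probability of the configuration [w] when the spins of the [n] vertices
    are independent with law [p]. *)
Definition iid_pmf p w : R := \prod_(i < n) p 0 (w i).

Lemma iid_pmf_ge0 p w : simplex R q p -> 0 <= iid_pmf p w.
Proof. by move=> [p0 _]; apply: prodr_ge0. Qed.

Lemma iid_expectation_prod p (g : 'I_n -> 'I_q -> R) :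
  \sum_w iid_pmf p w * \prod_(i < n) g i (w i) =
  \prod_(i < n) \sum_k p 0 k * g i k.
Proof.
rewrite bigA_distr_bigA; apply: eq_bigr => w _.
by rewrite -big_split.
Qed.

Lemma iid_pmf_sum1 p : simplex R q p -> \sum_w iid_pmf p w = 1.
Proof.
move=> [_ p1]; have := iid_expectation_prod p (fun _ _ => 1).
under eq_bigr do rewrite big1 ?mulr1 //; move=> ->.
by apply: big1 => i _; under eq_bigr do rewrite mulr1.
Qed.

Lemma simplex_le1 p k : simplex R q p -> p 0 k <= 1.
Proof.
by move=> [p0 <-]; rewrite (bigD1 k) //= lerDl sumr_ge0.
Qed.

(** The centred indicators that vertices [i] and [j] have spin [k] are
    uncorrelated, and bounded by [1]. *)
Lemma iid_covariance p k i j : simplex R q p ->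
  \sum_w iid_pmf p w * (((w i == k)%:R - p 0 k) * ((w j == k)%:R - p 0 k))
  <= (i == j)%:R.
Proof.
move=> sp; have [p0 p1] := sp; have pk := simplex_le1 k sp.
case: (eqVneq i j) => [<-|ij] /=.
  rewrite -[leRHS](iid_pmf_sum1 sp); apply: ler_sum => w _.
  rewrite ler_piMr ?iid_pmf_ge0 //; have := p0 k.
  by case: (w i == k) => /=; nra.
(* [g i] and [g j] are the centred indicators, the other factors are [1]; the
   factor at [i] of the factorised expectation vanishes. *)
pose d (l : 'I_q) : R := (l == k)%:R - p 0 k.
pose g (l : 'I_n) m : R := if (l == i) || (l == j) then d m else 1.
have -> : \sum_w iid_pmf p w * (((w i == k)%:R - p 0 k) * ((w j == k)%:R - p 0 k))
   = \sum_w iid_pmf p w * \prod_(l < n) g l (w l).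
  apply: eq_bigr => w _; congr (_ * _).
  rewrite (bigD1 i) //= (bigD1 j) /=; last by rewrite eq_sym.
  rewrite /g !eqxx orbT /= big1 ?mulr1 // => l /andP[/negbTE -> /negbTE ->].
  by [].
rewrite iid_expectation_prod (bigD1 i) //= /g eqxx /= /d.
under eq_bigr do rewrite mulrBr.
rewrite big_split /= sumrN -mulr_suml p1 mul1r (bigD1 k) //= eqxx mulr1.
rewrite big1 ?addr0 ?subrr ?mul0r // => l lk.
by rewrite (negbTE lk) mulr0.
Qed.

Lemma iid_variance_le p k : (0 < n)%N -> simplex R q p ->
  \sum_w iid_pmf p w * (magnetization R w 0 k - p 0 k) ^+ 2 <= n%:R^-1.
Proof.
move=> n0 sp; have nn0 : n%:R != 0 :> R by rewrite pnatr_eq0 -lt0n.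
have E w : (magnetization R w 0 k - p 0 k) ^+ 2 = n%:R^-1 ^+ 2 *
    \sum_(i < n) \sum_(j < n) ((w i == k)%:R - p 0 k) * ((w j == k)%:R - p 0 k).
  under eq_bigr do rewrite -mulr_sumr.
  rewrite -mulr_suml -expr2 -exprMn; congr (_ ^+ 2).
  rewrite magnetizationE big_split /= sumr_const card_ord mulrDr.
  by congr (_ + _); rewrite -[X in _ = _ * X]mulr_natl mulKf.
under eq_bigr do rewrite E mulrCA.
rewrite -mulr_sumr.
under eq_bigr do rewrite mulr_sumr.
rewrite exchange_big /=.
under eq_bigr do under eq_bigr do rewrite mulr_sumr.
under eq_bigr do rewrite exchange_big /=.
have : \sum_(i < n) \sum_(j < n) \sum_w
    iid_pmf p w * (((w i == k)%:R - p 0 k) * ((w j == k)%:R - p 0 k)) <= n%:R.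
  apply: (@le_trans _ _ (\sum_(i < n) \sum_(j < n) (i == j)%:R)).
    by apply: ler_sum => i _; apply: ler_sum => j _; exact: iid_covariance.
  have -> : \sum_(i < n) \sum_(j < n) (i == j)%:R = \sum_(i < n) 1 :> R.
    apply: eq_bigr => i _; rewrite (bigD1 i) //= eqxx big1 ?addr0 // => j ji.
    by rewrite eq_sym (negbTE ji).
  by rewrite sumr_const card_ord.
move=> /(ler_wpM2l (_ : 0 <= n%:R^-1 ^+ 2)) => /(_ (exprn_ge0 _ _)).
rewrite invr_ge0 ler0n => /(_ isT) /le_trans; apply.
by rewrite expr2 mulfVK.
Qed.

(** The configurations with a given magnetization [m] have total mass at most
    [1] under the product measure with marginal [m], and there are at most
    [n.+1 ^ q] magnetizations, as each is determined by its [q] counts. *)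
Lemma sum_iid_magnetization_le : (0 < n)%N ->
  \sum_(w : half_config q n) iid_pmf (magnetization R w) w <= n.+1%:R ^+ q.
Proof.
move=> n0.
pose c w : {ffun 'I_q -> 'I_n.+1} :=
  [ffun k => inord (\sum_(i < n) (w i == k))%N].
have cE w w' : c w = c w' -> magnetization R w = magnetization R w'.
  move=> /ffunP cw; apply/rowP => k; rewrite !magnetizationE; congr (_ * _).
  have b v : (\sum_(i < n) (v i == k) < n.+1)%N.
    rewrite ltnS -[X in (_ <= X)%N]card_ord -sum1_card.
    by apply: leq_sum => i _; case: (_ == _).
  move: (cw k); rewrite !ffunE => /(congr1 val) /=.
  rewrite !inordK // => /(congr1 (fun m => m%:R : R)).
  by rewrite !natr_sum.
rewrite (partition_big c xpredT) //=.
have -> : n.+1%:R ^+ q = \sum_(d : {ffun 'I_q -> 'I_n.+1}) 1 :> R.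
  by rewrite sumr_const card_ffun !card_ord natrX.
apply: ler_sum => d _.
case: (pickP [pred w | c w == d]) => [w0 /= /eqP cw0|none]; last first.
  by rewrite big1 // => w; have := none w => /= ->.
have sm := @magnetization_simplex R _ _ w0 n0.
rewrite -[leRHS](iid_pmf_sum1 sm) [leRHS](bigID (fun w => c w == d)) /=.
rewrite (eq_bigr (iid_pmf (magnetization R w0))).
  by rewrite lerDl sumr_ge0 // => w _; exact: iid_pmf_ge0.
by move=> w /eqP cw; rewrite (cE w w0) // cw.
Qed.

End ProductMeasure.

(** * Change of measure *)

Section ChangeOfMeasure.
Context {R : realType} {q : nat}.
Implicit Types (p x t : 'rV[R]_q) (u y : 'rV[R]_q * 'rV[R]_q).
Local Notation rho := (uniform_vec R q).

(** The average under [x] of the log-likelihood ratio of [p] to the uniform law;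
    for [p = x] it is the relative entropy of [x].  It is linear in [x], and [p]
    need not be normalised. *)
Definition cross_entropy p x : R := \sum_k x 0 k * ln (p 0 k / rho 0 k).

(** The free energy with the two logarithms evaluated at [u] instead of [y]:
    a continuous function of [y], equal to the free energy for [u = y]. *)
Definition tilted_energy (beta : R) u y : R :=
  cross_entropy u.1 y.1 + cross_entropy u.2 y.2 + beta * energy y.1 y.2.

Lemma tilted_energyxx beta y : tilted_energy beta y y = free_energy beta y.
Proof. by []. Qed.

Lemma expR_cross_entropy n p (w : half_config q n) : (0 < q)%N ->
  (forall i, 0 < p 0 (w i)) ->
  q%:R ^- n = iid_pmf p w * expR (- (n%:R * cross_entropy p (magnetization R w))).
Proof.
move=> q0 pw; have q1 : 0 < q%:R :> R by rewrite ltr0n.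
case: (posnP n) => [n0|n0].
  by subst n; rewrite mul0r oppr0 expR0 /iid_pmf big_ord0 expr0 invr1 mulr1.
rewrite /cross_entropy sum_magnetization mulrA divff ?pnatr_eq0 -?lt0n // mul1r.
rewrite -sumrN expR_sum -big_split /=.
rewrite (eq_bigr (fun=> q%:R^-1)) ?prodr_const ?card_ord ?exprVn // => i _.
have pi := pw i; rewrite mxE invrK expRN lnK ?posrE ?mulr_gt0 //.
by rewrite invfM mulVKf // gt_eqF.
Qed.

(** The density of the unnormalised Gibbs weight, with the factor [q ^- (2 * n)]
    included, with respect to the product measure with marginals [u.1] and
    [u.2]. *)
Lemma gibbs_weight_tilt beta n u (s : config q n) : (0 < q)%N -> (0 < n)%N ->
  (forall i, 0 < u.1 0 (s.1 i)) -> (forall i, 0 < u.2 0 (s.2 i)) ->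
  gibbs_weight beta s = iid_pmf u.1 s.1 * iid_pmf u.2 s.2 *
    expR (- (n%:R * tilted_energy beta u (magnetization_pair R s))).
Proof.
move=> q0 n0 u1 u2; rewrite /gibbs_weight hamiltonianE // mul2n -addnn exprD.
rewrite invfM {1}(expR_cross_entropy q0 u1) (expR_cross_entropy q0 u2).
rewrite /tilted_energy /= !mulrDr !opprD !expRD.
set A := expR (- (_ * cross_entropy _ _)).
set B := expR (- (_ * cross_entropy _ _)).
rewrite (_ : - beta * _ = - (n%:R * (beta * energy (magnetization R s.1)
   (magnetization R s.2)))); last by rewrite mulNr mulrCA.
by ring.
Qed.

Lemma gibbs_weight_ge0 (beta : R) n (s : config q n) : 0 <= gibbs_weight beta s.
Proof. by rewrite mulr_ge0 ?expR_ge0 // invr_ge0 exprn_ge0. Qed.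

Lemma iid_pmf_neq0_gt0 n p (w : half_config q n) : simplex R q p ->
  iid_pmf p w != 0 -> forall i, 0 < p 0 (w i).
Proof.
move=> [p0 _] /prodf_neq0 pw i; rewrite lt_def p0 andbT.
exact: pw.
Qed.

(** Without positivity of [u] only an inequality remains: configurations of
    product mass [0] may have positive Gibbs weight. *)
Lemma gibbs_weight_ge_tilt beta n u (s : config q n) : (0 < q)%N -> (0 < n)%N ->
  simplex R q u.1 -> simplex R q u.2 ->
  iid_pmf u.1 s.1 * iid_pmf u.2 s.2 *
    expR (- (n%:R * tilted_energy beta u (magnetization_pair R s)))
  <= gibbs_weight beta s.
Proof.
move=> q0 n0 u1 u2.
have [e|e] := eqVneq (iid_pmf u.1 s.1) 0.
  by rewrite e !mul0r gibbs_weight_ge0.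
have [e2|e2] := eqVneq (iid_pmf u.2 s.2) 0.
  by rewrite e2 mulr0 mul0r gibbs_weight_ge0.
by rewrite (@gibbs_weight_tilt _ _ u) //; apply: iid_pmf_neq0_gt0.
Qed.

Lemma gibbs_weightE beta n (s : config q n) : (0 < q)%N -> (0 < n)%N ->
  gibbs_weight beta s =
    iid_pmf (magnetization R s.1) s.1 * iid_pmf (magnetization R s.2) s.2 *
    expR (- (n%:R * free_energy beta (magnetization_pair R s))).
Proof.
move=> q0 n0; rewrite -tilted_energyxx.
by rewrite (@gibbs_weight_tilt _ _ (magnetization_pair R s)) // => i;
   exact: magnetization_gt0.
Qed.

End ChangeOfMeasure.

(** * The free energy and the rate function *)

Section FreeEnergy.
Context {R : realType} {q : nat}.
Context (beta : R) (q0 : (0 < q)%N) (beta0 : 0 < beta).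
Implicit Types (p x t : 'rV[R]_q) (u y : 'rV[R]_q * 'rV[R]_q).
Local Notation rho := (uniform_vec R q).
Local Notation D := (simplex R q `*` simplex R q).

Lemma uniform_gt0 k : 0 < rho 0 k.
Proof. by rewrite mxE invr_gt0 ltr0n. Qed.

Lemma simplex_uniform : simplex R q rho.
Proof.
split => [k|]; first exact/ltW/uniform_gt0.
under eq_bigr do rewrite mxE.
by rewrite sumr_const card_ord -[LHS]mulr_natl divff // pnatr_eq0 -lt0n.
Qed.

(** The tangent line at [t] of the convex function mapping [x] to
    [x * ln (x / r)] lies below it. *)
Lemma xlnx_ge_tangent (x t r : R) : 0 <= x -> 0 < t -> 0 < r ->
  x * ln (t / r) + (x - t) <= x * ln (x / r).
Proof.
move=> x0 t0 r0; have [->|xn0] := eqVneq x 0.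
  by rewrite !mul0r add0r sub0r oppr_le0 ltW.
have {}x0 : 0 < x by rewrite lt_def xn0.
rewrite !ln_div ?posrE //.
have : ln (t / x) <= t / x - 1.
  have := @le_ln1Dx R (t / x - 1); rewrite [1 + _]addrC subrK; apply.
  by rewrite ltrBrDl subrr divr_gt0.
rewrite ln_div ?posrE // => /(ler_wpM2l (ltW x0)).
rewrite mulrBr [x * (_ / _ - _)]mulrBr mulrCA divff // !mulr1.
by lra.
Qed.

(** A family of affine minorants of the relative entropy, indexed by positive
    vectors [t] that need not lie in the simplex. *)
Lemma relative_entropy_ge x t : simplex R q x -> (forall k, 0 < t 0 k) ->
  cross_entropy t x + (1 - \sum_k t 0 k) <= relative_entropy x rho.
Proof.
move=> [x0 <-] t0; rewrite -sumrB -big_split /=.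
by apply: ler_sum => k _; apply: xlnx_ge_tangent => //; exact: uniform_gt0.
Qed.

Lemma relative_entropy_ge0 x : simplex R q x -> 0 <= relative_entropy x rho.
Proof.
move=> sx; have := relative_entropy_ge sx uniform_gt0.
rewrite (proj2 simplex_uniform) subrr addr0; apply: le_trans.
rewrite /cross_entropy big1 // => k _.
by rewrite divff ?gt_eqF ?uniform_gt0 // ln1 mulr0.
Qed.

Lemma inner_le1 (x y : 'rV[R]_q) : simplex R q x -> simplex R q y ->
  inner x y <= 1.
Proof.
move=> [x0 <-] sy; apply: ler_sum => k _.
by rewrite ler_piMr // simplex_le1.
Qed.

Lemma free_energy_ge y : D y -> - beta <= free_energy beta y.
Proof.
move=> [s1 s2]; rewrite /free_energy /energy.
have := relative_entropy_ge0 s1; have := relative_entropy_ge0 s2.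
have := ler_wpM2l (ltW beta0) (inner_le1 s1 s2).
by rewrite mulrN; lra.
Qed.

Lemma continuous_tilted_energy u : continuous (tilted_energy beta u).
Proof.
have c1 k : continuous (fun y : 'rV[R]_q * 'rV[R]_q => y.1 0 k).
  move=> y; apply: (@continuous_comp _ _ _ fst (fun x : 'rV[R]_q => x 0 k)).
    exact: cvg_fst.
  exact: coord_continuous.
have c2 k : continuous (fun y : 'rV[R]_q * 'rV[R]_q => y.2 0 k).
  move=> y; apply: (@continuous_comp _ _ _ snd (fun x : 'rV[R]_q => x 0 k)).
    exact: cvg_snd.
  exact: coord_continuous.
have csum (h : 'I_q -> 'rV[R]_q * 'rV[R]_q -> R) :
    (forall k, continuous (h k)) -> continuous (fun y => \sum_k h k y).
  by move=> ch; apply: continuous_big => //; exact: add_continuous.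
move=> y; rewrite /tilted_energy /cross_entropy /energy /inner.
apply: cvgD; first apply: cvgD.
- apply: (csum (fun k y => y.1 0 k * _)) => k {}y.
  by apply: cvgM; [exact: c1|exact: cvg_cst].
- apply: (csum (fun k y => y.2 0 k * _)) => k {}y.
  by apply: cvgM; [exact: c2|exact: cvg_cst].
apply: cvgM; first exact: cvg_cst.
apply: cvgN; apply: (csum (fun k y => y.1 0 k * y.2 0 k)) => k {}y.
by apply: cvgM; [exact: c1|exact: c2].
Qed.

(** The affine minorants above approximate the relative entropy of [x]
    arbitrarily well: [t] is [x] with its zeros replaced by [e]. *)
Lemma cross_entropy_approx x (e : R) : simplex R q x -> 0 < e ->
  exists t, [/\ forall k, 0 < t 0 k, cross_entropy t x = relative_entropy x rho
    & \sum_k t 0 k <= 1 + q%:R * e].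
Proof.
move=> [x0 x1] e0; exists (\row_k (if x 0 k == 0 then e else x 0 k)); split.
- by move=> k; rewrite mxE; case: eqVneq => // xk; rewrite lt_def xk x0.
- apply: eq_bigr => k _; rewrite mxE; case: eqVneq => // ->.
  by rewrite !mul0r.
have -> : q%:R * e = \sum_(k < q) e by rewrite sumr_const card_ord mulr_natl.
rewrite -x1 -big_split /=; apply: ler_sum => k _; rewrite mxE.
by case: eqVneq => [->|_]; rewrite ?add0r // lerDl ltW.
Qed.

(** On [D] the sublevel set is the intersection of the closed sublevel sets of
    the minorants of the free energy. *)
Lemma sublevel_free_energy_closed (a : R) :
  relatively_closed D [set y | D y /\ free_energy beta y <= a].
Proof.
pose P := [set u : 'rV[R]_q * 'rV[R]_q |
  (forall k, 0 < u.1 0 k) /\ (forall k, 0 < u.2 0 k)].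
pose b u : R := a - (1 - \sum_k u.1 0 k) - (1 - \sum_k u.2 0 k).
exists (\bigcap_(u in P) (tilted_energy beta u @^-1` [set z | z <= b u])).
  apply: closed_bigI => u _; apply: preimage_closed; last exact: closed_le.
  by move=> y _; exact: continuous_tilted_energy.
apply/seteqP; split => y /=.
  move=> [[s1 s2] ya]; split=> // u [u1 u2] /=.
  have := relative_entropy_ge s1 u1; have := relative_entropy_ge s2 u2.
  by move: ya; rewrite /free_energy /tilted_energy /b; lra.
move=> [yb [s1 s2]]; split=> //; apply/ler_addgt0Pr => e e0.
have [|t1 [t10 c1 l1]] := @cross_entropy_approx y.1 (e / (2 * q%:R)) s1.
  by rewrite divr_gt0 // mulr_gt0 // ltr0n.
have [|t2 [t20 c2 l2]] := @cross_entropy_approx y.2 (e / (2 * q%:R)) s2.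
  by rewrite divr_gt0 // mulr_gt0 // ltr0n.
have qe : q%:R * (e / (2 * q%:R)) = e / 2.
  by field; rewrite pnatr_eq0 -lt0n.
have := yb (t1, t2) (conj t10 t20).
move: l1 l2; rewrite qe /b /tilted_energy /free_energy /= c1 c2.
by lra.
Qed.

(** The infimum [c] of the free energy is finite, so the rate is real-valued. *)
Lemma potts_rateE : exists c : R,
  [/\ forall y, D y -> c <= free_energy beta y,
      forall e, 0 < e -> exists2 y, D y & free_energy beta y < c + e
    & forall y, potts_rate beta y = (free_energy beta y - c)%:E].
Proof.
set S := [set (free_energy beta y)%:E | y in D].
have lb y : D y -> (ereal_inf S <= (free_energy beta y)%:E)%E.
  by move=> Dy; apply: ereal_inf_lbound; exists y.
have Sfin : ereal_inf S \is a fin_num.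
  rewrite fin_real //; apply/andP; split.
    apply: (@lt_le_trans _ _ (- beta)%:E); first exact: ltNyr.
    by apply: le_ereal_inf_tmp => _ [y Dy <-]; rewrite lee_fin free_energy_ge.
  apply: (le_lt_trans (lb (rho, rho) _)); last exact: ltry.
  by split; exact: simplex_uniform.
exists (fine (ereal_inf S)); split.
- by move=> y Dy; rewrite -lee_fin fineK // lb.
- move=> e e0; have [_ [y Dy <-]] := lb_ereal_inf_adherent e0 Sfin.
  by rewrite -(fineK Sfin) -EFinD lte_fin; exists y.
by move=> y; rewrite EFinB fineK.
Qed.

Lemma potts_rate_function : rate_function D (@potts_rate R q beta).
Proof.
have [c [c_le _ rE]] := potts_rateE; split => [y Dy|a].
  by rewrite rE lee_fin subr_ge0 c_le.
have := sublevel_free_energy_closed (a + c).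
congr relatively_closed; apply: eq_set => y.
by rewrite rE lee_fin lerBlDr.
Qed.

End FreeEnergy.

(** * Exponential asymptotics *)

Section Asymptotics.
Context {R : realType}.

(** A power of [n.+1] is eventually dominated by [expR (n * e)]: as
    [1 + t <= expR t], [n.+1] is at most a constant times [expR (n * b)] for
    every [b > 0]. *)
Lemma near_poly_le_expR (d : nat) (e : R) : 0 < e ->
  \forall n \near \oo, n.+1%:R ^+ d <= expR (n%:R * e).
Proof.
move=> e0; have b0 : 0 < e / 2 / d.+1%:R by rewrite !divr_gt0.
have e20 : 0 < e / 2 by rewrite divr_gt0.
set b := e / 2 / d.+1%:R in b0.
pose M : R := 1 + b^-1.
have M0 : 0 < M by rewrite addr_gt0 ?invr_gt0.
have h n : n.+1%:R ^+ d <= M ^+ d * expR (n%:R * (e / 2)).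
  apply: (@le_trans _ _ ((M * expR (n%:R * b)) ^+ d)).
    apply: lerXn2r; rewrite ?nnegrE ?mulr_ge0 ?expR_ge0 ?(ltW M0) //.
    apply: (@le_trans _ _ (M * (1 + n%:R * b))); last first.
      by rewrite ler_pM2l // expR_ge1Dx.
    have -> : M * (1 + n%:R * b) = 1 + n%:R * b + b^-1 + n%:R.
      by rewrite /M; field; rewrite gt_eqF.
    rewrite -natr1.
    have : 0 <= n%:R * b by rewrite mulr_ge0 // ltW.
    have : 0 <= b^-1 by rewrite invr_ge0 ltW.
    lra.
  rewrite exprMn ler_pM2l ?exprn_gt0 // -expRM_natl ler_expR.
  rewrite mulrCA; apply: ler_wpM2l => //.
  rewrite /b mulrA ler_pdivrMr // mulrC ler_pM2l //.
  by rewrite ler_nat.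
near=> n; apply: (le_trans (h n)).
have -> : n%:R * e = n%:R * (e / 2) + n%:R * (e / 2).
  by rewrite -mulrDr -splitr.
rewrite expRD ler_pM2r ?expR_gt0 //.
apply: (@le_trans _ _ (n%:R * (e / 2))).
  by rewrite -ler_pdivrMr //; near: n; exact: nbhs_infty_ger.
by apply: le_trans (expR_ge1Dx _); rewrite lerDr.
Unshelve. all: by end_near. Qed.

Lemma limn_esup_le_near (u : (\bar R)^nat) (l : \bar R) :
  (\forall n \near \oo, (u n <= l)%E) -> (limn_esup u <= l)%E.
Proof.
move=> ul; rewrite /limn_esup limf_esupE.
apply: (@le_trans _ _ (ereal_sup (u @` [set n | (u n <= l)%E]))).
  by apply: ereal_inf_lbound; exists [set n | (u n <= l)%E].
by apply: ge_ereal_sup => _ [n /= un <-].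
Qed.

Lemma limn_einf_ge_near (u : (\bar R)^nat) (l : \bar R) :
  (\forall n \near \oo, (l <= u n)%E) -> (l <= limn_einf u)%E.
Proof.
move=> lu; rewrite /limn_einf leeNr; apply: limn_esup_le_near.
by apply: filterS lu => n; rewrite leeN2.
Qed.

Lemma log_prob_le (T : Type) (mu : nat -> set T -> R) A n (a : R) : (0 < n)%N ->
  mu n A <= expR (n%:R * a) -> (log_prob mu A n <= a%:E)%E.
Proof.
move=> n0 h; have n1 : 0 < n%:R :> R by rewrite ltr0n.
rewrite /log_prob; have [m0|m0] := ltP 0 (mu n A).
  rewrite lne_EFin // -EFinM lee_fin mulrC ler_pdivrMr // mulrC.
  by rewrite -ler_expR lnK.
rewrite le0_lneNy ?lee_fin // gt0_muleNy ?leNye // lte_fin.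
by rewrite invr_gt0.
Qed.

Lemma log_prob_ge (T : Type) (mu : nat -> set T -> R) A n (a : R) : (0 < n)%N ->
  expR (n%:R * a) <= mu n A -> (a%:E <= log_prob mu A n)%E.
Proof.
move=> n0 h; have n1 : 0 < n%:R :> R by rewrite ltr0n.
have m0 := lt_le_trans (expR_gt0 _) h.
rewrite /log_prob lne_EFin // -EFinM lee_fin mulrC ler_pdivlMr // mulrC.
by rewrite -ler_expR lnK.
Qed.

End Asymptotics.

(** * Exponential bounds for the Gibbs mass *)

Section Laplace.
Context {R : realType} {q : nat}.
Context (beta : R) (q0 : (0 < q)%N).
Implicit Types (A : set ('rV[R]_q * 'rV[R]_q)) (p : 'rV[R]_q)
  (x y : 'rV[R]_q * 'rV[R]_q).
Local Notation D := (simplex R q `*` simplex R q).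

(** The unnormalised Gibbs mass of the event that the pair of magnetizations
    lies in [A]. *)
Definition gibbs_mass n A : R :=
  \sum_(s : config q n | s \in @magnetization_pair R q n @^-1` A)
    gibbs_weight beta s.

Lemma magnetization_pair_simplex n (s : config q n) : (0 < n)%N ->
  D (magnetization_pair R s).
Proof. by move=> n0; split; exact: magnetization_simplex. Qed.

Lemma magnetization_lawE n A : (0 < n)%N ->
  magnetization_law beta n A = gibbs_mass n A / gibbs_mass n D.
Proof.
move=> n0; rewrite /magnetization_law /gibbs_prob /gibbs_pmf -mulr_sumr mulrC.
congr (_ / _); rewrite /partition_function /gibbs_mass; apply: eq_bigl => s.
by symmetry; apply/mem_set; exact: magnetization_pair_simplex.
Qed.

Lemma sum_config n (f g : half_config q n -> R) :
  \sum_(s : config q n) f s.1 * g s.2 = (\sum_w f w) * \sum_w g w.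
Proof.
rewrite big_distrlr /= pair_bigA /=.
by apply: eq_bigr => -[].
Qed.

(** The exponential upper bound holds for arbitrary sets [A]. *)
Lemma gibbs_mass_le A (c : R) : (forall x, A x -> c <= free_energy beta x) ->
  forall e, 0 < e -> \forall n \near \oo, gibbs_mass n A <= expR (n%:R * (e - c)).
Proof.
move=> Ac e e0; near=> n.
have n0 : (0 < n)%N by near: n; exists 1%N.
pose m (w : half_config q n) := iid_pmf (magnetization R w) w.
have m_ge0 w : 0 <= m w by apply/iid_pmf_ge0/magnetization_simplex.
apply: (@le_trans _ _
  ((\sum_(s : config q n) m s.1 * m s.2) * expR (- (n%:R * c)))).
  rewrite mulr_suml [leRHS](bigID (mem (@magnetization_pair R q n @^-1` A))) /=.
  apply: ler_wpDr.
    by apply: sumr_ge0 => s _; rewrite !mulr_ge0 ?expR_ge0.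
  apply: ler_sum => s /set_mem sA; rewrite gibbs_weightE //.
  apply: ler_wpM2l; first by apply: mulr_ge0; exact: m_ge0.
  by rewrite ler_expR lerN2; apply: ler_wpM2l => //; exact: Ac.
rewrite mulrBr expRD ler_pM2r ?expR_gt0 // sum_config.
apply: (@le_trans _ _ (n.+1%:R ^+ q * n.+1%:R ^+ q)).
  by apply: ler_pM; rewrite ?sumr_ge0 // sum_iid_magnetization_le.
by rewrite -exprD; near: n; exact: near_poly_le_expR.
Unshelve. all: by end_near. Qed.

(** The squared Euclidean distance of pairs of vectors, a polynomial in the
    coordinates and hence computable under product measures. *)
Definition sq_dist x y : R :=
  \sum_k (y.1 0 k - x.1 0 k) ^+ 2 + \sum_k (y.2 0 k - x.2 0 k) ^+ 2.

Lemma sq_dist_ge0 x y : 0 <= sq_dist x y.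
Proof. by rewrite addr_ge0 // sumr_ge0 // => k _; exact: sqr_ge0. Qed.

Lemma iid_sq_dist_le n p : (0 < n)%N -> simplex R q p ->
  \sum_(w : half_config q n)
    iid_pmf p w * \sum_k (magnetization R w 0 k - p 0 k) ^+ 2 <= q%:R / n%:R.
Proof.
move=> n0 sp; under eq_bigr do rewrite mulr_sumr.
rewrite exchange_big /=.
have -> : q%:R / n%:R = \sum_(k < q) n%:R^-1 :> R.
  by rewrite sumr_const card_ord mulr_natl.
by apply: ler_sum => k _; exact: iid_variance_le.
Qed.

(** Weak law of large numbers for the pair of magnetizations of independent
    spins with laws [x.1] and [x.2]. *)
Lemma iid_concentration n x (r : R) (P : pred (config q n)) :
  (0 < n)%N -> D x -> 0 < r ->
  (forall s, ~~ P s -> r <= sq_dist x (magnetization_pair R s)) ->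
  1 - 2 * q%:R / n%:R / r <=
    \sum_(s : config q n | P s) iid_pmf x.1 s.1 * iid_pmf x.2 s.2.
Proof.
move=> n0 [s1 s2] r0 Pr.
pose Q (s : config q n) := iid_pmf x.1 s.1 * iid_pmf x.2 s.2.
have Q0 s : 0 <= Q s by rewrite mulr_ge0 // iid_pmf_ge0.
have Q1 : \sum_s Q s = 1 by rewrite sum_config !iid_pmf_sum1 ?mulr1.
have QV : \sum_s Q s * sq_dist x (magnetization_pair R s) <= 2 * q%:R / n%:R.
  pose d p (w : half_config q n) :=
    iid_pmf p w * \sum_k (magnetization R w 0 k - p 0 k) ^+ 2.
  rewrite (eq_bigr (fun s : config q n => d x.1 s.1 * iid_pmf x.2 s.2 +
     iid_pmf x.1 s.1 * d x.2 s.2)); last first.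
    by move=> s _; rewrite /Q /sq_dist /d /=; ring.
  rewrite big_split /= !sum_config !iid_pmf_sum1 // mulr1 mul1r.
  rewrite -mulrA mulr_natl mulr2n.
  by apply: lerD; exact: iid_sq_dist_le.
(* Markov's inequality for the squared distance. *)
have bad : (\sum_(s | ~~ P s) Q s) * r <= 2 * q%:R / n%:R.
  apply: le_trans QV; rewrite mulr_suml [leRHS](bigID P) /=.
  apply: ler_wpDl; first by apply: sumr_ge0 => s _; rewrite mulr_ge0 ?sq_dist_ge0.
  by apply: ler_sum => s /Pr; exact: ler_wpM2l.
rewrite -ler_pdivlMr // in bad; move: bad.
by rewrite -Q1 [X in _ -> X - _ <= _](bigID P) /=; rewrite /Q; lra.
Qed.

Lemma nbhs_sq_dist (U : set ('rV[R]_q * 'rV[R]_q)) x : nbhs x U ->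
  exists2 r : R, 0 < r & forall y, sq_dist x y < r -> U y.
Proof.
move=> /nbhs_ballP[d /= d0 dU]; exists (d ^+ 2); first exact: exprn_gt0.
move=> y xy; apply: dU.
have coord (v w : 'rV[R]_q) : \sum_k (w 0 k - v 0 k) ^+ 2 < d ^+ 2 -> ball v d w.
  move=> vw; split=> // i j; rewrite ord1 /ball /= distrC.
  rewrite -(@ltr_pXn2r _ 2) ?nnegrE ?(ltW d0) // real_normK ?num_real //.
  apply: le_lt_trans vw; rewrite (bigD1 j) //= lerDl sumr_ge0 // => k _.
  exact: sqr_ge0.
split => /=; apply: coord; apply: le_lt_trans xy; rewrite /sq_dist.
  by rewrite lerDl sumr_ge0 // => k _; exact: sqr_ge0.
by rewrite lerDr sumr_ge0 // => k _; exact: sqr_ge0.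
Qed.

Lemma gibbs_mass_ge A x : relatively_open D A -> A x ->
  forall e, 0 < e ->
    \forall n \near \oo,
      expR (- (n%:R * (free_energy beta x + e))) <= gibbs_mass n A.
Proof.
move=> [U openU ->] [Ux Dx] e e0; have e20 : 0 < e / 2 by rewrite divr_gt0.
have [r r0 rP] : exists2 r : R, 0 < r & forall y, sq_dist x y < r ->
    U y /\ tilted_energy beta x y < free_energy beta x + e / 2.
  apply: (nbhs_sq_dist (U := U `&`
    [set y | tilted_energy beta x y < free_energy beta x + e / 2])).
  apply: filterI; first exact: open_nbhs_nbhs.
  have /(_ _) := @continuous_tilted_energy R q beta x x.
  move=> /cvgr_lt; apply.
  by rewrite tilted_energyxx ltrDl.
near=> n.
have n0 : (0 < n)%N by near: n; exists 1%N.
have nn0 : 0 < n%:R :> R by rewrite ltr0n.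
pose P := [pred s : config q n | sq_dist x (magnetization_pair R s) < r].
have half : 2^-1 <= \sum_(s | P s) iid_pmf x.1 s.1 * iid_pmf x.2 s.2.
  apply: le_trans (iid_concentration n0 Dx r0 _); last first.
    by move=> s; rewrite /= -leNgt.
  have : 2 * q%:R / n%:R / r <= 2^-1.
    rewrite ler_pdivrMr // ler_pdivrMr // -ler_pdivrMl ?mulr_gt0 //.
    by near: n; exact: nbhs_infty_ger.
  by lra.
apply: (@le_trans _ _ (2^-1 * expR (- (n%:R * (free_energy beta x + e / 2))))).
  have -> : - (n%:R * (free_energy beta x + e)) =
      - (n%:R * (e / 2)) - n%:R * (free_energy beta x + e / 2) by lra.
  rewrite expRD ler_pM2r ?expR_gt0 // expRN lef_pV2 ?posrE ?expR_gt0 //.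
  apply: le_trans (expR_ge1Dx _).
  have : 1 <= n%:R * (e / 2).
    by rewrite -ler_pdivrMr //; near: n; exact: nbhs_infty_ger.
  by lra.
apply: (@le_trans _ _ ((\sum_(s | P s) iid_pmf x.1 s.1 * iid_pmf x.2 s.2) *
   expR (- (n%:R * (free_energy beta x + e / 2))))).
  by rewrite ler_pM2r ?expR_gt0.
rewrite mulr_suml /gibbs_mass [leRHS](bigID P) /=.
apply: ler_wpDr; first by apply: sumr_ge0 => s _; exact: gibbs_weight_ge0.
rewrite [leRHS](eq_bigl P); last first.
  move=> s /=; rewrite andb_idl // => /rP[Us _]; apply/mem_set; split => //.
  exact: magnetization_pair_simplex.
apply: ler_sum => s /rP[_ /ltW ts]; case: Dx => x1 x2.
apply: le_trans (gibbs_weight_ge_tilt beta s q0 n0 x1 x2).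
apply: ler_wpM2l; first by rewrite mulr_ge0 // iid_pmf_ge0.
by rewrite ler_expR lerN2; apply: ler_wpM2l.
Unshelve. all: by end_near. Qed.

End Laplace.

(** * The large deviation principle *)

Theorem theorem3p2 (R : realType) (q : nat) (beta : R) :
  (0 < q)%N -> 0 < beta ->
  LDP (simplex R q `*` simplex R q)
      (@magnetization_law R q beta)
      (@potts_rate R q beta).
Proof.
move=> q0 beta0; set D := simplex R q `*` simplex R q.
have [c [c_le c_approx rE]] := potts_rateE q0 beta0.
have openD : relatively_open D D.
  by exists setT; [exact: openT|rewrite setTI].
(* The normalising constant is eventually at least [expR (- n * (c + e))]. *)
have mass_ge e : 0 < e ->
    \forall n \near \oo, expR (n%:R * (- c - e)) <= gibbs_mass beta n D.
  move=> e0; have e20 : 0 < e / 2 by rewrite divr_gt0.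
  have [y Dy yc] := c_approx _ e20.
  apply: filterS (gibbs_mass_ge beta q0 openD Dy e20) => n; apply: le_trans.
  by rewrite -mulrN ler_expR; apply: ler_wpM2l => //; lra.
split; first exact: potts_rate_function.
- move=> F _.
  (* It suffices to treat real lower bounds [a] of the rate on [F]; the infimum
     may be infinite, when [F] is empty. *)
  suff ub : forall a : R, (forall x, F x -> a + c <= free_energy beta x) ->
      (limn_esup (log_prob (magnetization_law beta) F) <= (- a)%:E)%E.
    have ubm a : (a%:E <= ereal_inf [set potts_rate beta x | x in F])%E ->
        (limn_esup (log_prob (magnetization_law beta) F) <= (- a)%:E)%E.
      move=> am; apply: ub => x Fx; rewrite -lerBrDr -lee_fin -rE.
      by apply: (le_trans am); apply: ereal_inf_lbound; exists x.
    move: ubm; case: (ereal_inf _) => [m /(_ m) -> //|ubm|_]; last exact: leey.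
    rewrite leeNy_eq; case: (limn_esup _) ubm => [v|/(_ 0)|//].
    - by move=> /(_ (1 - v)); rewrite leey lee_fin => /(_ isT); lra.
    - by rewrite leey leye_eq => /(_ isT).
  move=> a aF; apply/lee_addgt0Pr => e e0; rewrite -EFinD.
  apply: limn_esup_le_near.
  have e20 : 0 < e / 2 by rewrite divr_gt0.
  near=> n.
  have n0 : (0 < n)%N by near: n; exists 1%N.
  have Zn : expR (n%:R * (- c - e / 2)) <= gibbs_mass beta n D.
    by near: n; exact: mass_ge.
  have Wn : gibbs_mass beta n F <= expR (n%:R * (e / 2 - (a + c))).
    by near: n; exact: gibbs_mass_le.
  apply: log_prob_le => //; rewrite magnetization_lawE //.
  rewrite ler_pdivrMr ?(lt_le_trans (expR_gt0 _) Zn) //.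
  apply: (le_trans Wn); apply: le_trans (ler_wpM2l (expR_ge0 _) Zn).
  by rewrite -expRD ler_expR -mulrDr; apply: ler_wpM2l => //; lra.
- move=> G openG; rewrite leeNl; apply: le_ereal_inf_tmp => _ [x Gx <-].
  rewrite leeNl rE -EFinN.
  have [U _ GE] := openG; have Dx : D x by move: Gx; rewrite GE => -[].
  apply/lee_subgt0Pr => e e0; rewrite -EFinB.
  apply: limn_einf_ge_near.
  have e20 : 0 < e / 2 by rewrite divr_gt0.
  near=> n.
  have n0 : (0 < n)%N by near: n; exists 1%N.
  have Z0 : 0 < gibbs_mass beta n D.
    apply: lt_le_trans (expR_gt0 (n%:R * (- c - e / 2))) _.
    by near: n; exact: mass_ge.
  have Zn : gibbs_mass beta n D <= expR (n%:R * (e / 2 - c)).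
    by near: n; exact: gibbs_mass_le.
  have Wn : expR (- (n%:R * (free_energy beta x + e / 2))) <= gibbs_mass beta n G.
    by near: n; exact: gibbs_mass_ge.
  apply: log_prob_ge => //; rewrite magnetization_lawE // ler_pdivlMr //.
  apply: le_trans Wn; apply: (le_trans (ler_wpM2l (expR_ge0 _) Zn)).
  by rewrite -expRD ler_expR -mulrDr -mulrN; apply: ler_wpM2l => //; lra.
Unshelve. all: by end_near. Qed.
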